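(* Let $(X_n)_{n\in\mathbb{N}}$ be a Markov chain on a finite state space $S$ with transition probability matrix $P$ and associated graph $G=(S,E)$. Let $C_1,\dots,C_l$ be the distinct maximal communicating classes of $G$. Then: (1) each $C_\nu$ is the support of exactly one invariant distribution $\mu_\nu$ of the Markov chain; (2) the chain has exactly $l$ extreme invariant distributions $\mu_1,\dots,\mu_l$; (3) any invariant distribution $\mu$ of the chain is a convex combination $\mu=\sum_{\nu=1}^l\alpha_\nu\mu_\nu$ with $\alpha_\nu\ge0$ and $\sum_{\nu=1}^l\alpha_\nu=1$.
   Context: Markov chains are time-homogeneous; $p(i,j)$ are the entries of $P$. The associated graph $G=(S,E)$ has $(i,j)\in E$ iff $p(i,j)>0$. Write $i\sim j$ if there are directed paths of length $\ge 1$ in $G$ from $i$ to $j$ and from $j$ to $i$; let $V_c=\{i\in S:i\sim j \text{ for some } j\in S\}$; the communicating classes of $G$ are the sets $[i]=\{j\in S: j\sim i\}$, $i\in V_c$. They are partially ordered by $C_\mu\preceq C_\nu$ iff there is a path in $G$ from some vertex of $C_\mu$ to some vertex of $C_\nu$; ''maximal'' means maximal with respect to $\preceq$. A probability distribution $\pi$ on $S$ (viewed as a column vector) is invariant if $\pi^T=\pi^TP$; its support is the smallest $S'\subset S$ with $\pi(S')=1$. An invariant distribution is extreme if it cannot be written as $\alpha\mu_1+(1-\alpha)\mu_2$ with $\mu_1\ne\mu_2$ invariant distributions and $\alpha\in(0,1)$. *)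

(* Defs.v *)
From mathcomp Require Import all_boot all_order all_algebra.
From mathcomp Require Import all_classical all_reals all_analysis.

Set Implicit Arguments.
Unset Strict Implicit.
Unset Printing Implicit Defensive.

Import Order.TTheory GRing.Theory Num.Theory.
Local Open Scope ring_scope.

Section Chain.
Context {R : realType} {S : finType}.
Implicit Types (P : S -> S -> R) (mu : {ffun S -> R}).

Definition stochastic P : Prop :=
  (forall i j, 0 <= P i j) /\ (forall i, \sum_j P i j = 1).

Definition cylinder {Omega : Type} (X : nat -> Omega -> S) (x : nat -> S)
    (n : nat) : set Omega :=
  [set w | forall k, (k <= n)%N -> X k w = x k]%classic.

(* S carries the discrete sigma-algebra, so measurability of X n amounts to
   measurability of its fibres.  The transition law is the conditional
   probability given the whole history, whenever the history has positive
   probability; the initial law is arbitrary. *)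
Definition markov_chain {d : measure_display} {Omega : measurableType d}
    (Pr : probability Omega R) (X : nat -> Omega -> S) P : Prop :=
  [/\ stochastic P,
      forall n i, measurable (X n @^-1` [set i])%classic &
      forall (n : nat) (x : nat -> S), (0 < Pr (cylinder X x n))%E ->
        fine (Pr (cylinder X x n.+1)) / fine (Pr (cylinder X x n))
          = P (x n) (x n.+1)].

Definition edge P : rel S := fun i j => 0 < P i j.

(* A directed path of length at least 1 is an edge followed by a possibly
   empty path, [connect] being the reflexive transitive closure. *)
Definition reach P : rel S :=
  fun i j => [exists k, edge P i k && connect (edge P) k j].

Definition comm P : rel S := fun i j => reach P i j && reach P j i.

Definition comm_vertices P : {set S} := finset (fun i => [exists j, comm P i j]).

Definition comm_class P (i : S) : {set S} := finset (fun j => comm P j i).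

Definition comm_classes P : {set {set S}} :=
  [set comm_class P i | i in comm_vertices P]%SET.

Definition class_le P : rel {set S} :=
  fun C D => [exists i in C, exists j in D, connect (edge P) i j].

Definition maximal_class P (C : {set S}) : Prop :=
  C \in comm_classes P /\
  forall D, D \in comm_classes P -> class_le P C D -> D = C.

Definition distribution mu : Prop :=
  (forall i, 0 <= mu i) /\ \sum_i mu i = 1.

Definition invariant_distribution P mu : Prop :=
  distribution mu /\ forall j, mu j = \sum_i mu i * P i j.

Definition is_support mu (A : {set S}) : Prop :=
  \sum_(i in A) mu i = 1 /\
  forall B : {set S}, \sum_(i in B) mu i = 1 -> A \subset B.

Definition extreme_invariant P mu : Prop :=
  invariant_distribution P mu /\
  ~ exists (mu1 mu2 : {ffun S -> R}) (a : R),
      [/\ invariant_distribution P mu1, invariant_distribution P mu2,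
          mu1 <> mu2, 0 < a < 1 &
          forall i, mu i = a * mu1 i + (1 - a) * mu2 i].

End Chain.

(* Main.v *)
(** If [v] is a signed stationary measure then [|v| <= |v| P] pointwise with
    equal total masses, so [|v|] and the positive part of [v] are stationary
    too.  With the singularity of [P - 1] this gives an invariant distribution
    on every non-empty absorbing set.  A nonnegative stationary measure stays
    stationary when restricted to an absorbing set, hence supports are unions
    of maximal classes; a maximal class is absorbing, and a stationary measure
    of mass zero living on it vanishes.  So the restriction of an invariant
    distribution to a maximal class is a multiple of the unique invariant
    distribution of that class, and these restrictions add up to it. *)
Require Import Defs.
From mathcomp Require Import all_boot all_order all_algebra.
From mathcomp Require Import all_classical all_reals all_analysis.

Import Order.TTheory GRing.Theory Num.Theory.
Local Open Scope ring_scope.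

(** * Stationary signed measures and absorbing sets *)

Section StationaryMeasures.
Set Implicit Arguments.
Unset Strict Implicit.
Context {R : realType} {S : finType}.
Implicit Types (P : S -> S -> R) (v m : S -> R) (A B C : {set S}) (i j k : S).

Definition stationary P v : Prop := forall j, v j = \sum_i v i * P i j.

Definition absorbing P A : Prop :=
  forall i j, i \in A -> edge P i j -> j \in A.

Definition restrict A v : S -> R := fun i => if i \in A then v i else 0.

Lemma sum1_exists_gt0 (I : finType) (F : I -> R) :
  (forall x, 0 <= F x) -> \sum_x F x = 1 -> exists x, 0 < F x.
Proof.
move=> F0 F1; have /psumr_neq0P : forall x, predT x -> 0 <= F x by [].
by rewrite F1 => /(_ (elimN eqP (oner_neq0 R)))[x]; exists x.
Qed.

Lemma sum_ge0_eq0 (F : S -> R) :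
  (forall i, 0 <= F i) -> \sum_i F i = 0 -> forall i, F i = 0.
Proof.
by move=> F0 /eqP; rewrite psumr_eq0// => /allP F_eq0 i;
  apply/eqP/F_eq0; rewrite mem_index_enum.
Qed.

Lemma stationaryD P a b v m : stationary P v -> stationary P m ->
  stationary P (fun i => a * v i + b * m i).
Proof.
move=> v_st m_st j; rewrite v_st m_st !mulr_sumr -big_split/=.
by apply: eq_bigr => i _; rewrite mulrDl !mulrA.
Qed.

Lemma sum_row P v : stochastic P -> \sum_j \sum_i v i * P i j = \sum_i v i.
Proof.
move=> [_ P1]; rewrite exchange_big/=; apply: eq_bigr => i _.
by rewrite -mulr_sumr P1 mulr1.
Qed.

(** By the triangle inequality each gap [\sum_i |v i| * P i j - |v j|] is nonnegative, and the gaps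
    sum to zero because the rows of [P] sum to one. *)
Lemma stationary_norm P v : stochastic P -> stationary P v ->
  stationary P (fun i => `|v i|).
Proof.
move=> Pst v_st j; apply/esym/eqP; rewrite -subr_eq0; apply/eqP.
move: j; apply: sum_ge0_eq0 => [j|].
  rewrite subr_ge0 {1}v_st; apply: le_trans (ler_norm_sum _ _ _) _.
  by apply: ler_sum => i _; rewrite normrM (ger0_norm (Pst.1 i j)).
by rewrite sumrB sum_row// subrr.
Qed.

(** The constant vector is fixed by [P], so [P - 1] is singular and also has a nonzero left kernel
    vector, possibly of mixed signs. The point [i0] makes [S] non-empty. *)
Lemma exists_stationary P i0 : stochastic P ->
  exists v, stationary P v /\ exists i, v i != 0.
Proof.
move=> Pst.
pose M : 'M[R]_#|S| :=
  (\matrix_(i, j) P (enum_val i) (enum_val j) - 1%:M)%R.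
have : \det M = 0.
  (* [det0P] yields row vectors, so the column of ones is tested against the transpose. *)
  rewrite -det_tr; apply/eqP/det0P; exists (const_mx 1).
    apply/negP => /eqP/matrixP/(_ ord0 (enum_rank i0)).
    by rewrite !mxE; apply/eqP; rewrite oner_eq0.
  apply/matrixP => x i; rewrite !mxE.
  under eq_bigr => j _ do rewrite !mxE mul1r.
  rewrite sumrB; apply/eqP; rewrite subr_eq0; apply/eqP.
  transitivity (1 : R).
    rewrite -(Pst.2 (enum_val i)).
    by rewrite [RHS](reindex _ (onW_bij _ (@enum_val_bij S))).
  rewrite (bigD1 i)//= eqxx big1 ?addr0// => j.
  by rewrite eq_sym => /negPf ->.
move=> /eqP/det0P[w w_neq0 wM0].
exists (fun i => w ord0 (enum_rank i)); split.
  move=> j; have /matrixP/(_ ord0 (enum_rank j)) := wM0.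
  rewrite mulmxBr mulmx1 !mxE => /eqP; rewrite subr_eq0 => /eqP <-.
  rewrite [RHS](reindex _ (onW_bij _ (@enum_val_bij S))).
  by apply: eq_bigr => i _; rewrite !mxE enum_valK enum_rankK.
apply/existsP; apply: contraNT w_neq0; rewrite negb_exists => /forallP w0.
apply/eqP/matrixP => x i; rewrite mxE ord1.
by have := w0 (enum_val i); rewrite negbK enum_valK => /eqP.
Qed.

(* Rows outside [A] are redirected to a point of [A], so that a stationary
   measure of the modified chain cannot charge the complement of [A]. *)
Lemma exists_stationary_absorbing P A : stochastic P -> absorbing P A ->
  A != finset.set0 -> exists m,
  [/\ stationary P m, forall i, 0 <= m i, \sum_i m i = 1 &
      forall i, i \notin A -> m i = 0].
Proof.
move=> Pst Aabs /finset.set0Pn[a aA].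
pose Q i j : R := if i \in A then P i j else (j == a)%:R.
have Qst : stochastic Q.
  split=> [i j|i]; rewrite /Q; case: (i \in A) => //.
  - exact: Pst.1.
  - exact: Pst.2.
  - by rewrite (bigD1 a)//= eqxx big1 ?addr0// => j /negPf ->.
have [v [v_st [i vi]]] := exists_stationary a Qst.
have n_st := stationary_norm Qst v_st.
have n0 j : j \notin A -> `|v j| = 0.
  move=> jA; rewrite n_st big1// => k _; rewrite /Q; case: ifP => [kA|_].
    suff -> : P k j = 0 by rewrite mulr0.
    apply/eqP; apply: contraNT jA => Pkj; apply: (Aabs k) => //.
    by rewrite /edge lt_neqAle eq_sym Pkj Pst.1.
  by case: eqP jA => [->|_]; rewrite ?aA ?mulr0.
pose s := \sum_j `|v j|.
have s_gt0 : 0 < s.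
  rewrite /s (bigD1 i)//=; apply: ltr_wpDr; last by rewrite normr_gt0.
  by apply: sumr_ge0.
exists (fun j => `|v j| / s); split=> [j|j||j jA].
(* Stationarity passes from [Q] to [P]: they differ only in rows outside [A], which carry no
   mass. *)
- rewrite n_st mulr_suml; apply: eq_bigr => k _.
  have [kA|kA] := boolP (k \in A); first by rewrite /Q kA mulrAC.
  by rewrite n0// !mul0r.
- by rewrite divr_ge0// ltW.
- by rewrite -mulr_suml divff// gt_eqF.
- by rewrite n0// mul0r.
Qed.

Lemma absorbing_connect P A i j :
  absorbing P A -> connect (edge P) i j -> i \in A -> j \in A.
Proof.
move=> Aabs /connectP[p]; elim: p i => [|k p IH] i /=; first by move=> _ ->.
by move=> /andP[ik kp] jE iA; apply: (IH k) => //; exact: Aabs ik.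
Qed.

Lemma connect_absorbing P i : absorbing P (finset (connect (edge P) i)).
Proof.
move=> j k; rewrite !finset.inE => ij jk.
exact: connect_trans ij (connect1 jk).
Qed.

Lemma absorbing_support P m : stochastic P -> stationary P m ->
  (forall i, 0 <= m i) -> absorbing P (finset (fun i => 0 < m i)).
Proof.
move=> Pst m_st m0 i j; rewrite !finset.inE => mi ij.
rewrite m_st (bigD1 i)//=; apply: ltr_wpDr; last exact: mulr_gt0.
by apply: sumr_ge0 => k _; apply: mulr_ge0 => //; exact: Pst.1.
Qed.

(* Mass cannot leave [B], so in equilibrium none can enter it. *)
Lemma stationary_restrict P m B : stochastic P -> stationary P m ->
  (forall i, 0 <= m i) -> absorbing P B -> stationary P (restrict B m).
Proof.
move=> Pst m_st m0 Babs.
have P0 i j : i \in B -> j \notin B -> P i j = 0.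
  move=> iB; apply: contraNeq => Pij; apply: (Babs i) => //.
  by rewrite /edge lt_neqAle eq_sym Pij Pst.1.
have r0 i : 0 <= restrict B m i by rewrite /restrict; case: ifP.
(* These gaps are nonnegative: at points of [B] only inflow from outside is dropped, and elsewhere
   nothing arrives from [B]. Their sum is zero. *)
suff H : forall j, restrict B m j - \sum_i restrict B m i * P i j = 0.
  by move=> j; apply/eqP; rewrite -subr_eq0 H.
apply: sum_ge0_eq0 => [j|]; last by rewrite sumrB sum_row// subrr.
rewrite subr_ge0 {2}/restrict; case: ifPn => jB.
  rewrite m_st; apply: ler_sum => i _; apply: ler_wpM2r; first exact: Pst.1.
  by rewrite /restrict; case: ifP.
rewrite big1// => i _; rewrite /restrict.
by case: ifP => iB; rewrite ?mul0r// P0 ?mulr0.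
Qed.

(** Let [B] be the set of states reachable from [j]. The part of [m] outside [B] is stationary; if
    it charged [i] it would charge [j] too, along the path, but [j] lies in [B]. *)
Lemma support_recurrent P m i j : stochastic P -> stationary P m ->
  (forall i, 0 <= m i) -> 0 < m i -> connect (edge P) i j ->
  connect (edge P) j i.
Proof.
move=> Pst m_st m0 mi ij; set B : {set S} := finset (connect (edge P) j).
have r_st := stationary_restrict Pst m_st m0 (@connect_absorbing P j).
have c_st := stationaryD 1 (-1) m_st r_st.
have mB k : 1 * m k + -1 * restrict B m k = if k \in B then 0 else m k.
  rewrite /restrict mul1r mulN1r; case: ifP => _; first by rewrite subrr.
  by rewrite subr0.
have c0 k : 0 <= 1 * m k + -1 * restrict B m k by rewrite mB; case: ifP.
have iB : i \in B.
  apply/negPn/negP => iB.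
  have /(_ _) := absorbing_connect (absorbing_support Pst c_st c0) ij.
  rewrite !finset.inE -/B !mB (negPf iB) => /(_ mi).
  by rewrite /B finset.inE connect0 ltxx.
by move: iB; rewrite finset.inE.
Qed.

Lemma stationary_sum0 P C v : stochastic P -> stationary P v ->
  (forall i, i \notin C -> v i = 0) ->
  (forall i j, i \in C -> j \in C -> connect (edge P) i j) ->
  \sum_i v i = 0 -> forall i, v i = 0.
Proof.
(* The positive part of [v] is stationary, so it vanishes or is positive on
   all of [C]; the latter contradicts the zero total mass. *)
move=> Pst v_st vC Cconn v_sum.
(* [v + |v|] is twice the positive part. *)
have p_st := stationaryD 1 1 v_st (stationary_norm Pst v_st).
have p_ge0 i : 0 <= 1 * v i + 1 * `|v i|.
  by rewrite !mul1r -lerBlDl sub0r -normrN ler_norm.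
have v_le0 i : v i <= 0.
  rewrite leNgt; apply/negP => vi.
  have iC : i \in C.
    by apply/negPn/negP => /vC vi0; rewrite vi0 ltxx in vi.
  have v_ge0 j : 0 <= v j.
    have [jC|/vC->//] := boolP (j \in C).
    have := absorbing_connect (absorbing_support Pst p_st p_ge0)
      (Cconn _ _ iC jC).
    rewrite !finset.inE !mul1r => /(_ (ltr_wpDr (normr_ge0 _) vi)).
    by case: (ger0P (v j)) => // vj; rewrite subrr ltxx.
  by rewrite (sum_ge0_eq0 v_ge0 v_sum) ltxx in vi.
move=> i; apply/eqP; rewrite -oppr_eq0; apply/eqP; move: i.
by apply: sum_ge0_eq0 => [i|]; rewrite ?oppr_ge0// sumrN v_sum oppr0.
Qed.

(** A set has mass one exactly when [m] vanishes off it, so the least such set is where [m] is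
    positive. *)
Lemma is_supportE (m : {ffun S -> R}) A : Defs.distribution m ->
  is_support m A <-> A = finset (fun i => 0 < m i).
Proof.
move=> [m0 m1].
have sumC B : \sum_(i in B) m i = 1 <-> forall i, i \notin B -> m i = 0.
  have := m1; rewrite (bigID (mem B))/= => mB; split=> [B1 i iB|B0].
    have : \sum_(i | i \notin B) m i = 0.
      by apply: (addrI (\sum_(i in B) m i)); rewrite mB addr0.
    by move=> /eqP; rewrite psumr_eq0// => /allP/(_ i);
      rewrite mem_index_enum iB => /(_ isT)/eqP.
  by move: mB; rewrite [X in _ + X]big1// addr0.
have posE i : (0 < m i) = (m i != 0) by rewrite lt0r m0 andbT.
split=> [[/sumC A0 Amin]|->].
  apply/eqP; rewrite finset.eqEsubset; apply/andP; split.
    apply: Amin; apply/sumC => i; rewrite finset.inE posE negbK.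
    exact: eqP.
  apply/fintype.subsetP => i; rewrite finset.inE posE.
  by apply: contraNT => /A0 ->.
split=> [|B /sumC B0].
  by apply/sumC => i; rewrite finset.inE posE negbK => /eqP.
apply/fintype.subsetP => i; rewrite finset.inE posE.
by apply: contraNT => /B0 ->.
Qed.

End StationaryMeasures.

(** * Maximal communicating classes and the measures they carry *)

Section MaximalClasses.
Set Implicit Arguments.
Unset Strict Implicit.
Context {R : realType} {S : finType} (P : S -> S -> R) (Pst : stochastic P).

Lemma reach_connect i j : reach P i j -> connect (edge P) i j.
Proof.
by move=> /existsP[k /andP[ik kj]]; exact: connect_trans (connect1 ik) kj.
Qed.

Lemma reach_trans_connect i j k :
  reach P i j -> connect (edge P) j k -> reach P i k.
Proof.
move=> /existsP[h /andP[ih hj]] jk; apply/existsP; exists h.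
by rewrite ih (connect_trans hj jk).
Qed.

Lemma connect_trans_reach i j k :
  connect (edge P) i j -> reach P j k -> reach P i k.
Proof.
move=> /connectP[[|h p]/=]; first by move=> _ ->.
move=> /andP[ih hp] -> jk; apply/existsP; exists h; rewrite ih/=.
by apply: connect_trans (reach_connect jk); apply/connectP; exists p.
Qed.

(** The representative lies on a cycle, so paths of length zero are harmless and [reach] can be
    traded for the reflexive [connect]. *)
Lemma comm_classP C : C \in comm_classes P ->
  exists2 i, reach P i i &
    C = finset (fun j => connect (edge P) i j && connect (edge P) j i).
Proof.
move=> /imsetP[i]; rewrite finset.inE => /existsP[j /andP[ij ji]] ->.
have ii := reach_trans_connect ij (reach_connect ji).
exists i => //; apply/finset.setP => k; rewrite !finset.inE /comm.
apply/andP/andP => [[ki ik]|[ik ki]]; split; try exact: reach_connect.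
  exact: connect_trans_reach ki ii.
exact: reach_trans_connect ii ik.
Qed.

Lemma class_connect C i j : C \in comm_classes P -> i \in C -> j \in C ->
  connect (edge P) i j.
Proof.
move=> /comm_classP[k _ ->]; rewrite !finset.inE => /andP[_ ik] /andP[kj _].
exact: connect_trans ik kj.
Qed.

Lemma class_mem C i j : C \in comm_classes P -> i \in C ->
  connect (edge P) i j -> connect (edge P) j i -> j \in C.
Proof.
move=> /comm_classP[k _ ->]; rewrite !finset.inE => /andP[ki ik] ij ji.
by rewrite (connect_trans ki ij) (connect_trans ji ik).
Qed.

Lemma class_neq0 C : C \in comm_classes P -> exists i, i \in C.
Proof.
by move=> /comm_classP[i _ ->]; exists i; rewrite finset.inE connect0.
Qed.

Lemma class_eq C D i : C \in comm_classes P -> D \in comm_classes P ->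
  i \in C -> i \in D -> C = D.
Proof.
move=> CP DP iC iD; apply/finset.setP => j; apply/idP/idP => jX.
  by apply: (class_mem DP iD); [exact: (class_connect CP)..].
by apply: (class_mem CP iC); [exact: (class_connect DP)..].
Qed.

(** Every state reachable from [i] leads back to [i]. An edge leaves [i] since its row sums to one,
    so [i] lies on a cycle and has a class; any class above it returns to [i], hence equals it. *)
Lemma support_maximal (m : S -> R) i : stationary P m ->
  (forall i, 0 <= m i) -> 0 < m i ->
  exists2 C, maximal_class P C & i \in C.
Proof.
move=> m_st m0 mi.
have rec j : connect (edge P) i j -> connect (edge P) j i.
  exact: (support_recurrent Pst m_st m0 mi).
have [k ik] : exists k, edge P i k := sum1_exists_gt0 (Pst.1 i) (Pst.2 i).
have ii : reach P i i.
  by apply/existsP; exists k; rewrite ik rec// connect1.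
have CP : comm_class P i \in comm_classes P.
  apply: imset_f; rewrite finset.inE; apply/existsP; exists i.
  by rewrite /comm ii.
have iC : i \in comm_class P i by rewrite finset.inE /comm ii.
exists (comm_class P i) => //; split=> // D DP.
move=> /exists_inP[j jC] /exists_inP[h hD jh].
apply: (@class_eq _ _ h) => //.
have ih := connect_trans (class_connect CP iC jC) jh.
by apply: (class_mem CP iC) => //; exact: rec.
Qed.

(* From the head of an edge leaving [C] one reaches the support of some
   invariant distribution, hence a communicating class, which is [C] by
   maximality. *)
Lemma maximal_absorbing C : maximal_class P C -> absorbing P C.
Proof.
move=> [CP Cmax] i j iC ij.
have [|m [m_st m0 m1 mj]] :=
  exists_stationary_absorbing Pst (@connect_absorbing _ _ P j).
  by apply/finset.set0Pn; exists j; rewrite finset.inE connect0.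
have [k mk] := sum1_exists_gt0 m0 m1.
have jk : connect (edge P) j k.
  apply/negPn/negP => jk; suff mk0 : m k = 0 by rewrite mk0 ltxx in mk.
  by apply: mj; rewrite finset.inE.
have [D [DP Dmax] kD] := support_maximal m_st m0 mk.
have DC : D = C.
  apply: Cmax => //; apply/exists_inP; exists i => //.
  by apply/exists_inP; exists k => //; exact: connect_trans (connect1 ij) jk.
rewrite DC in kD; apply: (class_mem CP iC (connect1 ij)).
exact: connect_trans jk (class_connect CP kD iC).
Qed.

(** The difference of the two sides is stationary, lives on [C] and has mass zero. *)
Lemma stationary_maximal_unique C (v m : S -> R) : maximal_class P C ->
  stationary P m -> \sum_i m i = 1 -> (forall i, i \notin C -> m i = 0) ->
  stationary P v -> (forall i, i \notin C -> v i = 0) ->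
  forall i, v i = (\sum_j v j) * m i.
Proof.
move=> [CP _] m_st m1 mC v_st vC i; apply/eqP; rewrite -subr_eq0.
have d_st := stationaryD 1 (- \sum_j v j) v_st m_st.
have <- : 1 * v i + - (\sum_j v j) * m i = v i - (\sum_j v j) * m i.
  by rewrite mul1r mulNr.
apply/eqP; move: i; apply: (stationary_sum0 (C := C) Pst d_st) => [i iC|i j|].
- by rewrite vC// mC// !mulr0 addr0.
- exact: class_connect.
- by rewrite big_split/= -!mulr_sumr m1 mul1r mulr1 subrr.
Qed.

Lemma exists_maximal_invariant C : maximal_class P C ->
  exists m : {ffun S -> R}, invariant_distribution P m /\ is_support m C.
Proof.
move=> Cmax; have [CP _] := Cmax; have Cabs := maximal_absorbing Cmax.
have [c cC] := class_neq0 CP.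
have [|m [m_st m0 m1 mC]] := exists_stationary_absorbing Pst Cabs.
  by apply/finset.set0Pn; exists c.
have mD : Defs.distribution [ffun i => m i].
  split=> [i|]; first by rewrite ffunE.
  by under eq_bigr => i _ do rewrite ffunE.
exists [ffun i => m i]; split.
  split=> // j; rewrite ffunE m_st; apply: eq_bigr => i _.
  by rewrite ffunE.
(* The support of [m] is absorbing and any two points of [C] are connected, so a zero of [m] in [C]
   would force [m] to vanish on [C]. *)
apply/(is_supportE _ mD); apply/finset.setP => i; rewrite finset.inE ffunE.
have [iC|/mC ->] := boolP (i \in C); last by rewrite ltxx.
apply/esym; rewrite lt_neqAle m0 andbT eq_sym; apply/eqP => mi0.
suff : \sum_i m i = 0 by rewrite m1; apply/eqP; exact: oner_neq0.
rewrite big1// => j _; have [jC|/mC//] := boolP (j \in C).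
apply/eqP; rewrite eq_le m0 andbT leNgt; apply/negP => mj.
have := absorbing_connect (absorbing_support Pst m_st m0)
  (class_connect CP jC iC).
by rewrite !finset.inE mi0 ltxx => /(_ mj).
Qed.

End MaximalClasses.

(** * Convex decomposition and extreme points *)

Theorem fact13 (R : realType) (S : finType)
    (d : measure_display) (Omega : measurableType d) (Pr : probability Omega R)
    (X : nat -> Omega -> S) (P : S -> S -> R) (hX : markov_chain Pr X P)
    (l : nat) (C : 'I_l -> {set S})
    (C_inj : injective C)
    (C_max : forall A : {set S}, maximal_class P A <-> exists nu, A = C nu) :
  exists mu : 'I_l -> {ffun S -> R},
    [/\ forall nu (m : {ffun S -> R}),
          invariant_distribution P m /\ is_support m (C nu) <-> m = mu nu,
        injective mu /\
        forall m : {ffun S -> R},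
          extreme_invariant P m <-> exists nu, m = mu nu &
        forall m : {ffun S -> R}, invariant_distribution P m ->
          exists alpha : 'I_l -> R,
            [/\ forall nu, 0 <= alpha nu,
                \sum_nu alpha nu = 1 &
                forall i, m i = \sum_nu alpha nu * mu nu i]].
Proof.
have [Pst _ _] := hX.
have Cm nu : maximal_class P (C nu) by apply/C_max; exists nu.
have [mu muP] := choice (fun nu => exists_maximal_invariant Pst (Cm nu)).
have muD nu : Defs.distribution (mu nu) by case: (muP nu) => -[].
have muC nu i : (i \in C nu) = (0 < mu nu i).
  have /(is_supportE _ (muD nu)) -> := (muP nu).2.
  by rewrite finset.inE.
have mu0 nu i : i \notin C nu -> mu nu i = 0.
  by move=> iC; apply/eqP; rewrite eq_le (muD nu).1 andbT leNgt -muC.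
have muU nu (v : S -> R) : stationary P v ->
    (forall i, i \notin C nu -> v i = 0) ->
    forall i, v i = (\sum_j v j) * mu nu i.
  move=> v_st vC.
  exact: (stationary_maximal_unique Pst (Cm nu) (muP nu).1.2 (muD nu).2
    (mu0 nu) v_st vC).
have muE nu (m : {ffun S -> R}) : invariant_distribution P m ->
    (forall i, i \notin C nu -> m i = 0) -> m = mu nu.
  by move=> [[_ m1] m_st] /(muU nu _ m_st) mE; apply/ffunP => i;
    rewrite mE m1 mul1r.
have Cdisj nu nu' i : i \in C nu -> i \in C nu' -> nu = nu'.
  move=> iC iC'; apply: C_inj.
  exact: (class_eq (Cm nu).1 (Cm nu').1 iC iC').
(* The coefficient of [mu nu] is the mass that [m] gives to [C nu]. *)
pose alpha (m : {ffun S -> R}) nu := \sum_j restrict (C nu) m j.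
have restrE m nu i : invariant_distribution P m ->
    restrict (C nu) m i = alpha m nu * mu nu i.
  move=> [[m0 _] m_st]; apply: (muU nu) => [|j jC].
    exact: (stationary_restrict Pst m_st m0 (maximal_absorbing Pst (Cm nu))).
  by rewrite /restrict (negPf jC).
have decomp m i : invariant_distribution P m ->
    m i = \sum_nu restrict (C nu) m i.
  move=> [[m0 _] m_st].
  have [mi|] := ltP 0 (m i); last first.
    move=> mi; have mi0 : m i = 0 by apply/eqP; rewrite eq_le mi m0.
    by rewrite big1 => [//|nu _]; rewrite /restrict mi0 if_same.
  have [A /C_max[nu ->] iC] := support_maximal Pst m_st m0 mi.
  rewrite (bigD1 nu)//= {1}/restrict iC big1 ?addr0// => nu' neq.
  rewrite /restrict; case: ifP => // iC'.
  by rewrite (Cdisj _ _ _ iC' iC) eqxx in neq.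
have alpha0 m nu : invariant_distribution P m -> 0 <= alpha m nu.
  by move=> [[m0 _] _]; apply: sumr_ge0 => i _; rewrite /restrict; case: ifP.
have alpha1 m : invariant_distribution P m -> \sum_nu alpha m nu = 1.
  move=> m_inv; rewrite /alpha exchange_big/= -m_inv.1.2.
  by apply: eq_bigr => i _; rewrite -decomp.
have mu_inj : injective mu.
  move=> nu nu' E; apply: C_inj; apply/finset.setP => i.
  by rewrite !muC E.
exists mu; split=> [nu m||m m_inv].
- split=> [[m_inv]|-> //].
  move=> /(is_supportE _ m_inv.1) CE; apply: muE => // i; rewrite CE.
  rewrite finset.inE -leNgt => mi.
  by apply/eqP; rewrite eq_le mi m_inv.1.1.
- split=> // m; split=> [[m_inv m_ext]|[nu ->]].
    (* Choose a class of positive mass [a] and split off [a * mu nu]; the remainder is nonnegative,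
       of mass [1 - a], and zero on [C nu]. *)
    have [nu a_gt0] := sum1_exists_gt0 (alpha0 m ^~ m_inv) (alpha1 m m_inv).
    exists nu; set a := alpha m nu in a_gt0.
    have a_le1 : a <= 1.
      rewrite -(alpha1 m m_inv) (bigD1 nu)//= lerDl.
      by apply: sumr_ge0 => k _; exact: alpha0.
    have rest i : m i - a * mu nu i = if i \in C nu then 0 else m i.
      rewrite -restrE// /restrict; case: ifP => _; first by rewrite subrr.
      by rewrite subr0.
    have rest0 i : 0 <= m i - a * mu nu i.
      by rewrite rest; case: ifP => // _; exact: m_inv.1.1.
    have restS : \sum_i (m i - a * mu nu i) = 1 - a.
      by rewrite sumrB -mulr_sumr m_inv.1.2 (muD nu).2 mulr1.
    have [a1|a_lt1] := eqVneq a 1.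
      apply/ffunP => i; apply/eqP; rewrite -subr_eq0 -[mu nu i]mul1r -a1.
      by apply/eqP; apply: (sum_ge0_eq0 rest0); rewrite restS a1 subrr.
    have b_gt0 : 0 < 1 - a by rewrite subr_gt0 lt_neqAle a_lt1.
    have b_neq0 : 1 - a != 0 by rewrite gt_eqF.
    exfalso; apply: m_ext.
    (* If [a < 1], the normalised remainder contradicts extremality: it vanishes on [C nu], where
       [mu nu] is positive. *)
    exists (mu nu), [ffun i => (1 - a)^-1 * (m i - a * mu nu i)], a.
    split.
    + exact: (muP nu).1.
    + split; first split=> [i|].
      * by rewrite ffunE mulr_ge0// invr_ge0 ltW.
      * under eq_bigr => i _ do rewrite ffunE.
        by rewrite -mulr_sumr restS mulVf.
      * move=> j; rewrite ffunE.
        have := stationaryD 1 (- a) m_inv.2 (muP nu).1.2 j.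
        rewrite mul1r mulNr => ->; rewrite mulr_sumr; apply: eq_bigr => i _.
        by rewrite ffunE mul1r mulNr mulrA.
    + have [c cC] := class_neq0 (Cm nu).1.
      move=> /ffunP/(_ c); rewrite ffunE rest cC mulr0 => muc.
      by move: cC; rewrite muC muc ltxx.
    + by rewrite a_gt0 lt_neqAle a_lt1.
    + by move=> i; rewrite ffunE mulVKf// addrC subrK.
  split; first exact: (muP nu).1.
  move=> [m1 [m2 [a [m1_inv m2_inv m12 /andP[a0 a1] mE]]]].
  have b0 : 0 < 1 - a by rewrite subr_gt0.
  (* Both components vanish wherever [mu nu] does, as their weights are positive; uniqueness on
     [C nu] then makes them equal. *)
  have m0 i : i \notin C nu -> m1 i = 0 /\ m2 i = 0.
    move=> /mu0; rewrite mE => /eqP.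
    rewrite paddr_eq0; [|exact: mulr_ge0 (ltW a0) (m1_inv.1.1 i)
                        |exact: mulr_ge0 (ltW b0) (m2_inv.1.1 i)].
    by rewrite !mulf_eq0 (gt_eqF a0) (gt_eqF b0)/= => /andP[/eqP-> /eqP->].
  have m1E : m1 = mu nu by apply: muE => // i /m0[].
  have m2E : m2 = mu nu by apply: muE => // i /m0[].
  by apply: m12; rewrite m1E m2E.
- exists (alpha m); split=> [nu||i]; [exact: alpha0|exact: alpha1|].
  by rewrite decomp//; apply: eq_bigr => nu _; rewrite restrE.
Qed.
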